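(* For every $n\ge1$, the number of matchings on $[2n]$ that avoid the pattern $12312$ equals the $3$-Catalan number $C_{n,3}=\frac{1}{2n+1}\binom{3n}{n}$.
   Context: A matching on $[2n]$ is a partition of $[2n]$ into $n$ blocks of size two (edges). The canonical sequential form of a matching with $n$ edges is the word of length $2n$ obtained by labeling edges $1,\dots,n$ in increasing order of their smaller elements and writing at each position the label of the edge containing it. Words $a_1\cdots a_k$, $b_1\cdots b_k$ are order-isomorphic if $a_i<a_j\iff b_i<b_j$ for all $i,j$. A matching contains a pattern $\tau$ if its canonical sequential form has a subsequence order-isomorphic to $\tau$, and avoids $\tau$ otherwise. The $k$-Catalan numbers are $C_{n,k}=\frac{1}{(k-1)n+1}\binom{kn}{n}$. *)

(* Defs.v *)
From mathcomp Require Import all_boot all_order all_algebra.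

Set Implicit Arguments.
Unset Strict Implicit.
Unset Printing Implicit Defensive.

Section Matchings.
Variable n : nat.

(* The point i of [2n] = {1, ..., 2n} is represented by the ordinal i - 1. *)
Definition is_matching (M : {set {set 'I_(2 * n)}}) : bool :=
  partition M [set: 'I_(2 * n)] && [forall B in M, #|B| == 2].

Definition edge_min (B : {set 'I_(2 * n)}) : nat :=
  \big[minn/2 * n]_(i in B) i.

(* The rank of B, counted from 1, among the edges of M sorted by smaller
   element: distinct edges of a matching have distinct smaller elements. *)
Definition edge_label (M : {set {set 'I_(2 * n)}}) (B : {set 'I_(2 * n)}) : nat :=
  #|[set B' in M | edge_min B' <= edge_min B]|.

Definition canonical_form (M : {set {set 'I_(2 * n)}}) : seq nat :=
  [seq edge_label M (pblock M i) | i <- enum 'I_(2 * n)].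

End Matchings.

Definition order_isomorphic (a b : seq nat) : bool :=
  (size a == size b) &&
  [forall i : 'I_(size a), forall j : 'I_(size a),
     (nth 0 a i < nth 0 a j) == (nth 0 b i < nth 0 b j)].

(* Subsequences are enumerated by masks so that containment is boolean;
   word_containsP gives the formulation with subseq. *)
Definition word_contains (w tau : seq nat) : bool :=
  [exists m : (size w).-tuple bool, order_isomorphic (mask m w) tau].

Lemma word_containsP (w tau : seq nat) :
  reflect (exists2 s, subseq s w & order_isomorphic s tau)
          (word_contains w tau).
Proof.
apply: (iffP existsP) => [[m mw] | [s /subseqP[m sz_m ->] iso]].
  by exists (mask m w) => //; apply: mask_subseq.
by exists (tcast sz_m (in_tuple m)); rewrite val_tcast.
Qed.

Definition avoids (n : nat) (M : {set {set 'I_(2 * n)}}) (tau : seq nat) : bool :=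
  ~~ word_contains (canonical_form M) tau.

Definition k_catalan (n k : nat) : rat :=
  (((k%:R - 1) * n%:R + 1)^-1 * 'C((k * n)%N, n)%:R)%R.

Definition avoiding_matchings (n : nat) (tau : seq nat) :
    {set {set {set 'I_(2 * n)}}} :=
  [set M | is_matching M && avoids M tau].

(* Main.v *)
Require Import Defs.
From mathcomp Require Import all_boot all_order all_algebra.
From mathcomp Require Import zify.

Set Implicit Arguments.
Unset Strict Implicit.
Unset Printing Implicit Defensive.

(**
  Name every edge by its smaller element and read the word of a matching from
  left to right.  Since each letter occurs twice, 12312 occurs exactly when
  two crossing edges [a < b] have an opener between [b] and the end of [a].
  Hence a matching avoids 12312 iff every closing step closes either the most
  recently opened of the open edges, or the second most recent one provided
  that the edge opened last is still open.  The number of ways to complete such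
  a word depends only on the number of remaining letters, the number [h] of
  open edges, and whether the edge opened last is still open.

  Let [P_h] and [Q_h] be the generating functions, by number of edges still to
  be opened, of the completions in the two cases (still open, already closed).
  Then [Q_0 = 1 + x P_1], [Q_h = x P_{h+1} + Q_{h-1}] and
  [P_h = Q_h + P_{h-1}], with [P_0 = 0].  With [T = 1 + x T^3], the solution is
  [Q_0 = T] and [P_h = T^3 r_h(T)], where [r_0 = 0], [r_1 = 1] and
  [r_{h+2} = (T^2 + T) r_{h+1} - T^2 r_h].
*)

(** * Solving the recurrence *)

(** The summands: open a new edge, close the most recent open edge, or close the second most recent
    one. The last needs [b] and leaves the edge opened last still open. *)
Fixpoint walk_count (N h : nat) (b : bool) : nat :=
  if N is N'.+1 then
    walk_count N' h.+1 true
    + (if h is h'.+1 then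
         walk_count N' h' false
         + (if h' is _.+1 then if b then walk_count N' h' true else 0 else 0)
       else 0)
  else h == 0.

Section Counting.
Import GRing.Theory.
Local Open Scope ring_scope.

(* The coefficient of x^k in T^p. *)
Definition ternary_coef (p k : nat) : int :=
  if k is j.+1 then
    'C(3 * j + p + 2, j.+1)%N%:Z - 2 * 'C(3 * j + p + 2, j)%N%:Z
  else 1.

(** The constant series [T^0 = 1]. *)
Lemma ternary_coef0 k : ternary_coef 0 k.+1 = 0.
Proof.
rewrite /ternary_coef addn0.
have := mul_bin_left (3 * k + 2) k.
have -> : (3 * k + 2 - k = 2 * k.+1)%N by lia.
rewrite [(2 * _)%N]mulnC -mulnA => /eqP; rewrite eqn_pmul2l // => /eqP; lia.
Qed.

(** This is [T^(p+1) = T^p + x T^(p+3)]. The division-free form of [p/(3k+p) C(3k+p, k)] reduces it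
    to Pascal's rule. *)
Lemma ternary_coefS p k :
  ternary_coef p.+1 k.+1 = ternary_coef p k.+1 + ternary_coef (p + 3) k.
Proof.
case: k => [|k]; rewrite /ternary_coef.
  by rewrite !bin0 !bin1; lia.
have -> : (3 * k.+1 + p.+1 + 2 = (3 * k + p + 5).+1)%N by lia.
have -> : (3 * k.+1 + p + 2 = 3 * k + p + 5)%N by lia.
have -> : (3 * k + (p + 3) + 2 = 3 * k + p + 5)%N by lia.
rewrite !binS; lia.
Qed.

Lemma ternary_coef_closed n :
  (2 * n + 1)%N%:Z * ternary_coef 1 n = 'C(3 * n, n)%N%:Z.
Proof.
case: n => [|k] //; rewrite /ternary_coef.
have -> : (3 * k + 1 + 2 = 3 * k.+1)%N by lia.
have := mul_bin_left (3 * k.+1) k.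
have -> : (3 * k.+1 - k = 2 * k + 3)%N by lia.
move: 'C(_, _) 'C(_, _) => a b; nia.
Qed.

(* The coefficient of x^k in T^p r_h(T). *)
Fixpoint walk_series (h p k : nat) : int :=
  match h with
  | 0 => 0
  | 1 => ternary_coef p k
  | (h'.+1 as h1).+1 =>
      walk_series h1 (p + 2) k + walk_series h1 p.+1 k - walk_series h' (p + 2) k
  end.

Lemma walk_series0 p k : walk_series 0 p k = 0.
Proof. by []. Qed.

Lemma walk_seriesSS h p k : walk_series h.+2 p k =
  walk_series h.+1 (p + 2) k + walk_series h.+1 p.+1 k - walk_series h (p + 2) k.
Proof. by []. Qed.

(** At [x = 0] one has [T = 1], and the recurrence becomes [r_{h+2} = 2 r_{h+1} - r_h]. *)
Lemma walk_series_k0 h p : walk_series h p 0 = h%:Z.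
Proof.
elim/ltn_ind: h p => -[|[|h]] IH p //.
by rewrite walk_seriesSS !IH //; lia.
Qed.

(* x T^3 = T - 1 *)
Lemma walk_series_shift h p k :
  walk_series h p.+1 k.+1 = walk_series h p k.+1 + walk_series h (p + 3) k.
Proof.
elim/ltn_ind: h p => -[|[|h]] IH p //; first exact: ternary_coefS.
rewrite !walk_seriesSS !addSn !IH //.
rewrite [(p + 3 + 2)%N]addnAC -[(p + 3).+1]addSn; lia.
Qed.

(* (T - 1) r_{h+3} = T^3 (r_{h+2} - 2 r_{h+1} + r_h) *)
Lemma walk_series_diff h p k :
  walk_series h.+3 p.+1 k - walk_series h.+3 p k =
  walk_series h.+2 (p + 3) k - 2 * walk_series h.+1 (p + 3) k
  + walk_series h (p + 3) k.
Proof.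
(* Both sides are polynomials in [T] obeying the recurrence of [r], so the cases [h = 0, 1] suffice;
   the first reads [(T-1)(T^4 + 2T^3) = T^3(T^2 + T - 2)]. *)
elim/ltn_ind: h p => -[|[|h]] IH p.
- rewrite !walk_seriesSS !addSn !addnS !addn0 /=; lia.
- rewrite !walk_seriesSS !addSn !addnS !addn0 /=; lia.
- have H1 := IH h.+1 (ltnSn _) (p + 2)%N.
  have H2 := IH h.+1 (ltnSn _) p.+1.
  have H3 := IH h (ltnW (ltnSn _)) (p + 2)%N.
  rewrite (walk_seriesSS h.+3 p.+1) (walk_seriesSS h.+3 p).
  rewrite (walk_seriesSS h.+2 (p + 3)) (walk_seriesSS h.+1 (p + 3)) (walk_seriesSS h (p + 3)).
  rewrite !addSn !addnS !addn0 in H1 H2 H3 *; lia.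
Qed.

(* The coefficient of x^k in P_h if [b], in Q_h otherwise. *)
Definition walk_value (h k : nat) (b : bool) : int :=
  if b then walk_series h 3 k
  else if h is h'.+1 then walk_series h 3 k - walk_series h' 3 k
  else ternary_coef 1 k.

Lemma walk_value00 k : walk_value 0 k.+1 false = walk_value 1 k true.
Proof. by rewrite /walk_value ternary_coefS ternary_coef0 add0r. Qed.

Lemma walk_valueF0 h : walk_value h 0 false = 1.
Proof. by rewrite /walk_value; case: h => // h; rewrite !walk_series_k0; lia. Qed.

(** Coefficientwise [Q_{h+1} = x P_{h+2} + Q_h]. Replacing [x T^3] by [T - 1] in [x P_{h+2}] reduces
    it to [walk_series_diff], or to [T^3 = (T-1)(T^2+T) + T] when [h = 0]. *)
Lemma walk_valueFS h k : walk_value h.+1 k.+1 false =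
  walk_value h.+2 k true + walk_value h k.+1 false.
Proof.
have E j : walk_series j 3 k = walk_series j 1 k.+1 - walk_series j 0 k.+1.
  by rewrite walk_series_shift addrAC subrr add0r.
rewrite /walk_value E; case: h => [|h].
  rewrite !walk_seriesSS !walk_series0 -[(0 + 2)%N]/2%N -[(1 + 2)%N]/3%N.
  by rewrite -[ternary_coef 1 _]/(walk_series 1 1 k.+1); lia.
by rewrite walk_series_diff add0n; lia.
Qed.

Lemma walk_valueTS h k :
  walk_value h.+1 k true = walk_value h.+1 k false + walk_value h k true.
Proof. by rewrite /walk_value; lia. Qed.

Lemma walk_count_lt N h b : (N < h)%N -> walk_count N h b = 0%N.
Proof.
elim: N h b => [|N IH] [|h] b //= lt.
rewrite (IH h.+2); last by lia.
rewrite (IH h); last by lia.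
by case: h b lt => // h [] // lt; rewrite IH //; lia.
Qed.

(** Here [k] edges are still to be opened: each needs two letters, and each open edge one. *)
Lemma walk_countE N h k b : N = (h + 2 * k)%N -> b ==> (0 < h)%N ->
  (walk_count N h b)%:Z = walk_value h k b.
Proof.
elim: N h k b => [|N IH] h k b.
  by case: h k b => [|h] [|k] [] //; lia.
move=> EN hb.
have F : b = false \/ b = true by case: b {hb}; [right|left].
have Eo : (walk_count N h.+1 true)%:Z =
          if k is k'.+1 then walk_value h.+1 k' true else 0.
  (* For [k = 0], one more opening would leave fewer letters than open edges. *)
  case: k EN => [|k] EN; first by rewrite walk_count_lt //; lia.
  by rewrite (IH _ k) //; lia.
rewrite /= PoszD Eo.
case: h EN hb {Eo} => [|h] EN hb.
  by case: b hb {F} => // _; case: k EN => // k EN; rewrite walk_value00 addr0.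
rewrite PoszD (IH h k false) //; last by lia.
have -> : (if h is _.+1 then if b then walk_count N h true else 0%N else 0%N)%:Z
          = if b then walk_value h k true else 0.
  case: h EN {hb} => [|h] EN; first by case: (b).
  by case: (b) => //; rewrite (IH h.+1 k) //; lia.
have EF : walk_value h.+1 k false =
   (if k is k'.+1 then walk_value h.+2 k' true else 0) + walk_value h k false.
  by case: k {EN} => [|k]; rewrite ?walk_valueF0 // walk_valueFS.
by case: F => ->; rewrite ?walk_valueTS EF ?addr0 ?addrA.
Qed.

Lemma walk_count_catalan n : (walk_count (2 * n) 0 false)%:R = k_catalan n 3.
Proof.
have := ternary_coef_closed n.
rewrite -[ternary_coef 1 n]/(walk_value 0 n false).
rewrite -(@walk_countE (2 * n) 0 n false) //.
rewrite /k_catalan -PoszM => -[<-].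
have -> : (3%:R - 1) * n%:R + 1 = (2 * n + 1)%N%:R :> rat.
  by rewrite natrD natrM; congr (_ * _ + _).
by rewrite natrM mulKf // Num.Theory.pnatr_eq0 addn1.
Qed.

End Counting.

(** * Words of 12312-avoiding matchings *)

Lemma gtn_trans : transitive gtn.
Proof. by move=> x y z /= A B; apply: ltn_trans B A. Qed.

(* The words of length [N] that can be written from position [i] when [s] lists
   the open edges, most recent first, and [b] tells whether the edge opened last
   is still open. *)
Fixpoint words (N i : nat) (s : seq nat) (b : bool) : seq (seq nat) :=
  if N is N'.+1 then
    [seq i :: w | w <- words N' i.+1 (i :: s) true]
    ++ (if s is t :: s' then
          [seq t :: w | w <- words N' i.+1 s' false]
          ++ (if s' is t2 :: s'' then
                if b then [seq t2 :: w | w <- words N' i.+1 (t :: s'') true]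
                else [::]
              else [::])
        else [::])
  else if s is [::] then [:: [::]] else [::].

Lemma size_words N i s b : size (words N i s b) = walk_count N (size s) b.
Proof.
elim: N i s b => [|N IH] i s b /=; first by case: s.
rewrite size_cat size_map IH; congr (_ + _).
case: s => //= t s; rewrite size_cat size_map IH; congr (_ + _).
by case: s b => //= t2 s [] //; rewrite size_map IH.
Qed.

Lemma map_cons_uniq (T : eqType) (x : T) (ws : seq (seq T)) :
  uniq [seq x :: w | w <- ws] = uniq ws.
Proof. by apply: map_inj_uniq => u v []. Qed.

Lemma mem_map_cons (T : eqType) (x y : T) w (ws : seq (seq T)) :
  (y :: w \in [seq x :: v | v <- ws]) = (y == x) && (w \in ws).
Proof.
apply/mapP/andP => [[v vws [-> ->]]|[/eqP-> wws]]; first by rewrite eqxx.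
by exists w.
Qed.

Lemma nil_map_cons (T : eqType) (x : T) (ws : seq (seq T)) :
  ([::] \in [seq x :: v | v <- ws]) = false.
Proof. by apply/mapP => -[]. Qed.

Lemma cons_words N i s b y w : (y :: w \in words N.+1 i s b) =
  [|| (y == i) && (w \in words N i.+1 (i :: s) true),
      (if s is t :: s' then (y == t) && (w \in words N i.+1 s' false) else false)
    | (if s is t :: t2 :: s' then
         b && (y == t2) && (w \in words N i.+1 (t :: s') true) else false)].
Proof.
rewrite /= mem_cat mem_map_cons; congr (_ || _).
case: s => // t s; rewrite mem_cat mem_map_cons; congr (_ || _).
by case: s b => // t2 s []; rewrite // mem_map_cons.
Qed.

(** The three branches start with different letters, since [s] decreases strictly and stays below
    [i]. *)
Lemma words_uniq N i s b :
  all (gtn i) s -> sorted gtn s -> uniq (words N i s b).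
Proof.
elim: N i s b => [|N IH] i s b /= lt_s so_s; first by case: s {lt_s so_s}.
have le_s s' : subseq s' s -> all (gtn i.+1) s'.
  move=> /mem_subseq sub; apply/allP => x /sub /(allP lt_s) /=; exact: leqW.
have so s' : subseq s' s -> sorted gtn s' by move/(subseq_sorted gtn_trans); apply.
rewrite cat_uniq map_cons_uniq IH /=; last 2 first.
- by rewrite ltnSn le_s.
- by rewrite (path_sortedE gtn_trans) lt_s so_s.
case: s lt_s so_s le_s so => //= t s /andP[lt_t lt_s] so_s le_s so.
rewrite cat_uniq map_cons_uniq IH /=; last 2 first.
- exact/le_s/subseq_cons.
- exact/so/subseq_cons.
apply/andP; split.
  apply/hasPn => -[|y w]; rewrite !mem_cat ?nil_map_cons //=.
  rewrite !mem_map_cons => H; apply/negP => /andP[/eqP Ey _]; move: H; rewrite Ey.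
  case/orP=> [/andP[/eqP E _]|]; first by rewrite E ltnn in lt_t.
  case: s b lt_s so_s {le_s so} => // t2 s [] //= /andP[lt_2 _] _.
  by rewrite mem_map_cons => /andP[/eqP E _]; rewrite E ltnn in lt_2.
case: s b lt_s so_s le_s so => // t2 s [] //= /andP[lt_2 _] /andP[lt_2t _] le_s so.
have sub : subseq (t :: s) [:: t, t2 & s] 
  by apply: (@cat_subseq _ [:: t] s [:: t]); rewrite ?subseq_refl ?subseq_cons.
rewrite map_cons_uniq IH ?so ?le_s // andbT.
apply/hasPn => -[|y w]; rewrite ?nil_map_cons // !mem_map_cons.
case/andP => /eqP-> _; case: eqP => //= E; by rewrite E ltnn in lt_2t.
Qed.

(* [w] completes a matching word from position [i], [s] listing the edges then
   open; an edge is named by the position of its smaller element. *)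
Definition completes (i : nat) (s w : seq nat) : Prop :=
  (forall j, j < size w -> nth 0 w j <= i + j) /\
  (forall x : nat, count_mem x w =
     (x \in s) + 2 * ((i <= x) && (nth x.+1 w (x - i) == x))).

(* No occurrence of 12312 whose last two letters lie in [w]; [c] is the last
   opener before position [i], which is the best choice for the letter 3. *)
Definition safe (i c : nat) (w : seq nat) : Prop :=
  forall j1 j2 d, j1 < j2 < size w -> nth 0 w j1 < nth 0 w j2 < i + j1 ->
    nth 0 w j2 < d -> d < i + j1 ->
    d = c \/ (i <= d /\ nth 0 w (d - i) = d) -> False.

Lemma completes_nil i s : completes i s [::] <-> s = [::].
Proof.
split=> [[_ H]|->]; last first.
  (* The default [x.+1] in [completes] makes the test fail beyond the end of the word. *)
  split=> // x; rewrite nth_nil; have -> : (x.+1 == x) = false by lia.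
  by rewrite andbF.
by case: s H => // t s /(_ t); rewrite inE eqxx.
Qed.

(** Of the two letters due to an edge opened at [i], one is the head; the other is due to [i] as an
    open edge. *)
Lemma completes_open i s w : i \notin s ->
  completes i s (i :: w) <-> completes i.+1 (i :: s) w.
Proof.
move=> iNs; split=> -[H1 H2]; split.
- by move=> j lt_j; have := H1 j.+1 lt_j; rewrite /=; lia.
- move=> x; have := H2 x; rewrite /= inE [i == x]eq_sym.
  case: (ltngtP x i) => [lt|lt|->] /=.
  + by rewrite !addn0.
  + by have -> : x - i = (x - i.+1).+1 by lia.
  + by rewrite subnn eqxx (negPf iNs) /=; lia.
- by case=> [|j]; rewrite ?addn0 //= => lt_j; have := H1 j lt_j; lia.
- move=> x; have := H2 x; rewrite /= inE [i == x]eq_sym.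
  case: (ltngtP x i) => [lt|lt|->] /=.
  + by rewrite !addn0.
  + by have -> : x - i = (x - i.+1).+1 by lia.
  + by rewrite subnn eqxx (negPf iNs) /=; lia.
Qed.

(** A letter [y < i] cannot open an edge in the rest, so its occurrence there forces [y \in s] and
    uses up its count. *)
Lemma completes_close (i y : nat) (s w : seq nat) :
  uniq s -> i \notin s -> y != i ->
  completes i s (y :: w) <-> [/\ y \in s, y < i & completes i.+1 (rem y s) w].
Proof.
move=> us iNs yi.
have E x : x \in rem y s = (x != y) && (x \in s) by rewrite mem_rem_uniq.
split=> [[H1 H2]|[ys lt_y [H1 H2]]].
  have lt_y : y < i by have := H1 0 isT; rewrite /=; lia.
  have ys : y \in s by have := H2 y; rewrite /= eqxx; lia.
  split=> //; split=> [j lt_j|x]; first by have := H1 j.+1 lt_j; rewrite /=; lia.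
  have := H2 x; rewrite E /= [y == x]eq_sym.
  case: (ltngtP x i) => [lt|lt|Ex].
  - by case: eqP => [->|] /=; lia.
  - have -> : x - i = (x - i.+1).+1 by lia.
    by case: eqP => [Exy|] /=; lia.
  - by rewrite Ex subnn /=; case: eqP => /=; lia.
split=> [[|j]|x] /=; first by move=> _; rewrite addn0; apply: ltnW.
  by move=> lt_j; have := H1 j lt_j; lia.
have := H2 x; rewrite E /= [y == x]eq_sym.
case: (ltngtP x i) => [lt|lt|Ex].
- by case: eqP => [->|_] /=; rewrite ?ys; lia.
- have -> : x - i = (x - i.+1).+1 by lia.
  by case: eqP => [Exy|] /=; lia.
- by rewrite Ex subnn /=; case: eqP => /=; lia.
Qed.

(** If [y] is the second 1 of an occurrence, the letter 3 was opened before [i], hence is [c].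
    Otherwise the last two letters lie in [w], and [c] is updated when [y] opens an edge. *)
Lemma safe_cons i c y w : c <= i ->
  safe i c (y :: w) <->
  (forall x, x \in w -> y < x -> x < i -> x < c -> c < i -> False) /\
  safe i.+1 (if y == i then i else c) w.
Proof.
move=> le_c; split=> [H|[H1 H2]].
  split=> [x xw yx xi xc ci|j1 j2 d /andP[j12 j2s] /= lt1 lt2 lt3 Hd].
    apply: (H 0 (index x w).+1 c) => /=; rewrite ?ltnS ?index_mem ?nth_index ?addn0 //.
      by rewrite yx xi.
    by left.
  apply: (H j1.+1 j2.+1 d) => //=; try lia.
  case: Hd => [->|[le_d Ed]].
    by case: eqP => [->|_]; [right; rewrite subnn|left].
  right; split; first lia.
  by have -> : d - i = (d - i.+1).+1 by lia.
move=> [|j1] [|j2] d // /andP[j12 /= j2s] /= lt1 lt2 lt3 Hd.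
  have dc : d = c by case: Hd => // -[]; lia.
  by apply: (H1 (nth 0 w j2)); rewrite ?mem_nth -?dc //; lia.
case: eqP H2 => [Ey|nEy] H2.
  (* If [d <= i], the newer opener [i] also serves as the letter 3. *)
  have [di|di] := leqP d i.
    apply: (H2 j1 j2 i) => //; try lia; left.
  apply: (H2 j1 j2 d) => //; try lia.
  right; split=> //; case: Hd => [|[_]]; first lia.
  by have -> : d - i = (d - i.+1).+1 by lia.
apply: (H2 j1 j2 d) => //; try lia.
case: Hd => [->|[le_d Ed]]; [by left|right].
have [Edi|ne] := eqVneq d i.
  by rewrite Edi subnn /= in Ed.
split; first lia.
by move: Ed; have -> : d - i = (d - i.+1).+1 by lia.
Qed.

(* [b] tells whether the edge opened last, at [c], is still open. *)
Record walk_state (i c : nat) (s : seq nat) (b : bool) : Prop := WalkState {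
  ws_lt : all (gtn i) s;
  ws_sorted : sorted gtn s;
  ws_last : if b then s = c :: behead s else all (gtn c) s;
  ws_le : c <= i;
  ws_open : s != [::] -> c < i }.

Lemma completes_mem i s (w : seq nat) x :
  completes i s w -> x < i -> (x \in w) = (x \in s).
Proof.
move=> [_ H] lt_x; rewrite -has_pred1 has_count H [i <= x]leqNgt lt_x addn0.
by case: (x \in s).
Qed.

Lemma walk_state_open i c s b :
  walk_state i c s b -> walk_state i.+1 i (i :: s) true.
Proof.
case=> lt_s so_s _ _ _; split=> //=; last by rewrite (path_sortedE gtn_trans) lt_s.
by rewrite ltnSn; apply: sub_all lt_s => x /leqW.
Qed.

Lemma walk_state_close i c t s b :
  walk_state i c (t :: s) b -> walk_state i.+1 c s false.
Proof.
case=> /= /andP[lt_t lt_s] so_s last le_c op; split=> //.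
- by apply: sub_all lt_s => x /leqW.
- exact: path_sorted so_s.
- case: b last => [[tc]|/andP[]//].
  by move: so_s; rewrite tc (path_sortedE gtn_trans) => /andP[].
- exact: leqW.
Qed.

Lemma walk_state_close2 i c t t2 s :
  walk_state i c [:: t, t2 & s] true -> walk_state i.+1 c (t :: s) true.
Proof.
case=> /= /and3P[lt_t lt_2 lt_s] /andP[lt2t so_s] [tc] le_c op; split=> //=.
- by rewrite ltnS ltnW //; apply: sub_all lt_s => x /leqW.
- move: so_s; rewrite !(path_sortedE gtn_trans) => /andP[a ->]; rewrite andbT.
  by apply: sub_all a => x /= lt; apply: ltn_trans lt lt2t.
- by rewrite tc.
- exact: leqW.
Qed.

(** For a closing letter [y], the new condition from [safe_cons] says that no open edge lies
    strictly between [y] and [c] ([cond]). This allows the top of [s], the second entry when the top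
    is [c], and nothing else. *)
Lemma mem_words N i c s b w : walk_state i c s b ->
  w \in words N i s b <-> size w = N /\ completes i s w /\ safe i c w.
Proof.
elim: N i c s b w => [|N IH] i c s b w st.
  split=> [|[/size0nil-> [/completes_nil-> _]]] //.
  case: s {st} => //; rewrite inE => /eqP->; split=> //; split; first exact/completes_nil.
  by move=> j1 j2 d /andP[].
case: w => [|y w].
  split=> [|[]//]; rewrite /= mem_cat nil_map_cons.
  case: s {st} => // t s; rewrite mem_cat nil_map_cons.
  by case: s b => // t2 s []; rewrite // nil_map_cons.
have [lt_s so_s last le_c op] := st.
have iNs : i \notin s by apply/negP => /(allP lt_s); rewrite /= ltnn.
have us : uniq s by apply: sorted_uniq gtn_trans _ _ so_s => x; rewrite /= ltnn.
have -> : size (y :: w) = N.+1 <-> size w = N by split=> [[]|/= ->].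
rewrite safe_cons // cons_words.
have [-> {y}|yi] := eqVneq y i.
  have F1 t s' : s = t :: s' -> (i == t) = false.
    by move=> E; move: iNs; rewrite E inE negb_or => /andP[/negPf].
  have F2 t t2 s' : s = [:: t, t2 & s'] -> (i == t2) = false.
    by move=> E; move: iNs; rewrite E !inE !negb_or => /and3P[_ /negPf].
  have -> : (if s is t :: s' then (i == t) && (w \in words N i.+1 s' false)
             else false) = false.
    by case: (s) F1 => // t s' /(_ _ _ erefl)->.
  have -> : (if s is [:: t, t2 & s'] then
       b && (i == t2) && (w \in words N i.+1 (t :: s') true) else false) = false.
    by case: (s) F2 => // t [|t2 s'] // /(_ _ _ _ erefl)->; rewrite andbF.
  rewrite !orbF /= completes_open // IH; last exact: walk_state_open st.
  split=> [[? [? ?]]|[? [? [? ?]]]]; do !split=> //; move=> x _; lia.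
rewrite completes_close //=.
have cond : completes i.+1 (rem y s) w -> y \in s ->
    (forall x, x \in w -> y < x -> x < i -> x < c -> c < i -> False) <->
    (forall x, x \in s -> y < x -> c <= x).
  move=> cw ys; have ci : c < i by apply: op; case: (s) ys.
  split=> H x; last first.
    move=> xw yx xi xc _; move: xw.
    rewrite (completes_mem cw) ?leqW // mem_rem_uniq // inE => /andP[_ xs].
    by have := H x xs yx; rewrite leqNgt xc.
  move=> xs yx; rewrite leqNgt; apply/negP => xc.
  have xi : x < i by exact: (allP lt_s).
  apply: (H x) => //; rewrite (completes_mem cw) ?leqW // mem_rem_uniq // inE xs andbT.
  by rewrite gtn_eqF.
case: s st lt_s so_s last op iNs us cond => [|t s] st lt_s so_s last op iNs us cond.
  by split=> // -[_ [[]]].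
have lt_y : y \in t :: s -> y < i by move/(allP lt_s).
have t_max x : x \in s -> x < t.
  by move: so_s; rewrite /= (path_sortedE gtn_trans) => /andP[/allP H _] /H.
have [Ey|yt] := eqVneq y t.
  subst y; rewrite /= eqxx in cond *.
  have -> : (if s is t2 :: s' then
     b && (t == t2) && (w \in words N i.+1 (t :: s') true) else false) = false.
    case: (s) t_max => // t2 s' /(_ t2); rewrite inE eqxx => /(_ isT) lt2.
    by rewrite (gtn_eqF lt2) andbF.
  rewrite orbF (IH _ _ _ _ _ (walk_state_close st)) mem_head in cond *.
  split=> [[sz [cw sf]]|[sz [[_ _ cw] [_ sf]]]]; do 2!split=> //.
    by split=> //; apply: lt_y; rewrite mem_head.
  split=> //; apply/(cond cw isT) => x; rewrite inE => /orP[/eqP->|/t_max].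
    by rewrite ltnn.
  by move=> lt1 lt2; rewrite ltnNge ltnW in lt1.
rewrite /= in cond *.
have ty : (t == y) = false by rewrite eq_sym (negPf yt).
rewrite ty in cond *.
(* If the edge opened last is closed, then [y < t < c] is forbidden. *)
case: b last st => [[tc]|/= /andP[tc lt_c]] st; last first.
  have -> : (if s is t2 :: s' then
     false && (y == t2) && (w \in words N i.+1 (t :: s') true) else false) = false.
    by case: (s).
  split=> // -[sz [[ys _ cw] [H _]]].
  move: ys; rewrite inE (negPf yt) /= => ys.
  have := (cond cw _).1 H t; rewrite inE ys orbT mem_head t_max // leqNgt tc.
  by move=> /(_ isT isT isT).
case: s st lt_s so_s op iNs us cond lt_y t_max => [|t2 s] st lt_s so_s op iNs us cond lt_y t_max.
  by split=> // -[_ [[]]]; rewrite inE (negPf yt).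
have t2_max x : x \in s -> x < t2.
  move: so_s; rewrite /= => /andP[_]; rewrite (path_sortedE gtn_trans).
  by case/andP=> /allP H _ /H.
have [Ey|yt2] := eqVneq y t2.
  subst y; rewrite /= eqxx (IH _ _ _ _ _ (walk_state_close2 st)) in cond *.
  split=> [[sz [cw sf]]|[sz [[_ _ cw] [_ sf]]]]; do 2!split=> //.
    by split=> //; rewrite ?lt_y // !inE eqxx orbT.
  split=> //; apply/(cond cw) => [|x]; rewrite !inE ?eqxx ?orbT //.
  case/or3P=> [/eqP->|/eqP->|/t2_max]; rewrite ?tc ?ltnn //.
  by move=> lt1 lt2; rewrite ltnNge ltnW in lt1.
(* Now [y < t2 < t = c], so [t2] violates the condition. *)
rewrite /=; split=> // -[sz [[ys _ cw] [H _]]].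
move: ys; rewrite !inE (negPf yt) (negPf yt2) /= => ys.
have := (cond cw _).1 H t2; rewrite !inE ys eqxx !orbT t2_max // leqNgt -tc t_max ?mem_head //.
by move=> /(_ isT isT isT).
Qed.

(** The initial [c = 0] stands for no opener: [safe] asks for a letter below [d], so [d = 0] never
    arises. *)
Lemma mem_words0 N w :
  w \in words N 0 [::] false <-> size w = N /\ completes 0 [::] w /\ safe 0 0 w.
Proof. by apply: mem_words; split. Qed.

(** * From matchings to words *)

Lemma order_isomorphicP (a b : seq nat) :
  reflect (size a = size b /\ forall i j, i < size a -> j < size a ->
             (nth 0 a i < nth 0 a j) = (nth 0 b i < nth 0 b j))
          (order_isomorphic a b).
Proof.
apply: (iffP andP) => -[]; last first.
  move=> sz H; split; first exact/eqP.
  by apply/forallP => i; apply/forallP => j; apply/eqP/H.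
move=> /eqP sz /forallP H; split=> // i j lt_i lt_j.
by have /forallP/(_ (Ordinal lt_j))/eqP := H (Ordinal lt_i).
Qed.

(** Only the relative order of letters matters; this lets edges be named by their smaller elements
    instead of their ranks. *)
Lemma word_contains_map (T : eqType) (f g : T -> nat) (l : seq T) tau :
  {in l &, forall x y, (f x < f y) = (g x < g y)} ->
  word_contains [seq f x | x <- l] tau -> word_contains [seq g x | x <- l] tau.
Proof.
move=> fg /word_containsP[_ /subseqP[m _ ->] /order_isomorphicP].
rewrite -map_mask size_map => -[sz iso].
apply/word_containsP; exists [seq g x | x <- mask m l].
  by rewrite map_mask mask_subseq.
apply/order_isomorphicP; rewrite size_map; split=> // i j lt_i lt_j.
have [x0 _] : exists x0 : T, true by case: (mask m l) lt_i => // x; exists x.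
have mem k : k < size (mask m l) -> nth x0 (mask m l) k \in l.
  by move=> lt_k; apply: (mem_subseq (mask_subseq m l)); apply: mem_nth.
by rewrite -iso // !(nth_map x0) // fg ?mem.
Qed.

Lemma sorted_subseq_iota q N :
  sorted ltn q -> all (gtn N) q -> subseq q (iota 0 N).
Proof.
move=> so lt_q.
suff -> : q = [seq x <- iota 0 N | x \in q] by apply: filter_subseq.
apply: (irr_sorted_eq ltn_trans ltnn) => //.
  exact/(sorted_filter ltn_trans)/iota_ltn_sorted.
move=> x; rewrite mem_filter mem_iota add0n /=.
by case: (boolP (x \in q)) => // /(allP lt_q).
Qed.

Lemma completes_fix (w : seq nat) x : completes 0 [::] w -> x \in w ->
  x < size w /\ nth 0 w x = x.
Proof.
move=> [_ H] xw; have : 0 < count_mem x w by rewrite -has_count has_pred1.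
rewrite H in_nil subn0 /=; case: (ltnP x (size w)) => [lt_x|ge_x].
  by rewrite (set_nth_default 0) //; case: eqP.
by rewrite nth_default //; case: eqP => // E; lia.
Qed.

Lemma safe_avoids (w : seq nat) : completes 0 [::] w ->
  safe 0 0 w <-> ~~ word_contains w [:: 1; 2; 3; 1; 2].
Proof.
move=> cw; split=> [sf|].
  apply/negP => /word_containsP[_ /subseqP[m sz_m ->] /order_isomorphicP].
  have -> : mask m w = [seq nth 0 w k | k <- mask m (iota 0 (size w))].
    by rewrite map_mask; congr mask; rewrite -[LHS](mkseq_nth 0).
  have so : sorted ltn (mask m (iota 0 (size w))).
    exact: (subseq_sorted ltn_trans (mask_subseq _ _) (iota_ltn_sorted _ _)).
  have : all (gtn (size w)) (mask m (iota 0 (size w))).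
    by apply/allP => x /(mem_subseq (mask_subseq _ _)); rewrite mem_iota.
  move: so; move: (mask m _) => q so lt_q; rewrite size_map => -[sz iso].
  case: q so lt_q sz iso => [|p1 [|p2 [|p3 [|p4 [|p5 [|//]]]]]] //=.
  move=> /and5P[l12 l23 l34 l45 _] /and5P[k1 k2 k3 k4 /andP[k5 _]] _ iso.
  have := iso 0 1 isT isT; have := iso 1 2 isT isT.
  have := iso 0 3 isT isT; have := iso 3 0 isT isT.
  have := iso 1 4 isT isT; have := iso 4 1 isT isT => /= i1 i2 i3 i4 i5 i6.
  have [_ E3] := completes_fix cw (mem_nth 0 k3).
  have [B _] := cw.
  have B2 := B _ k2; have B3 := B _ k3.
  (* Letters never exceed their positions, so the letters 2 and 3 are both below [p4]. *)
  apply: (sf p4 p5 (nth 0 w p3)); try lia.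
  by right; rewrite subn0.
move=> av j1 j2 d /andP[j12 j2s] lt1 lt2 lt3 Hd.
have {Hd} Ed : nth 0 w d = d by case: Hd => [|[_]]; [lia|rewrite subn0].
have [_ E1] := completes_fix cw (mem_nth 0 (ltn_trans j12 j2s)).
have [_ E2] := completes_fix cw (mem_nth 0 j2s).
case/negP: av; apply/word_containsP.
(* A letter is the position of its opener, so the letters themselves give the first three
   positions. *)
exists [seq nth 0 w k | k <- [:: nth 0 w j1; nth 0 w j2; d; j1; j2]].
  rewrite -[X in subseq _ X](mkseq_nth 0); apply: map_subseq.
  by apply: sorted_subseq_iota; rewrite /=; lia.
apply/order_isomorphicP; split=> //; rewrite /= E1 E2 Ed.
have [a1 a2] : nth 0 w j1 < nth 0 w j2 /\ nth 0 w j2 < d by lia.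
by move=> [|[|[|[|[|i]]]]] [|[|[|[|[|j]]]]] //= _ _; lia.
Qed.

(** * The bijection between matchings and words *)

Section OpenerWord.
Variable n : nat.
Implicit Types (M : {set {set 'I_(2 * n)}}) (B : {set 'I_(2 * n)}).

Lemma edge_min_le B i : i \in B -> edge_min B <= i.
Proof.
rewrite /edge_min; have : i \in index_enum 'I_(2 * n) by rewrite mem_index_enum.
elim: index_enum => // x r IH; rewrite inE big_cons => /orP[/eqP<- ->|ir iB].
  exact: geq_minl.
by case: ifP => _; rewrite ?IH // geq_min IH ?orbT.
Qed.

Lemma edge_min_mem B i : i \in B -> exists2 m, m \in B & edge_min B = m.
Proof.
move=> iB; have : edge_min B = 2 * n \/ exists2 m, m \in B & edge_min B = m.
  rewrite /edge_min; elim/big_rec: _ => [|j x jB IH]; first by left.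
  right; case: (leqP j x) => // lt; first by exists j.
  case: IH => // E; move: lt; rewrite E ltnNge ltnW //.
by case=> // E; have := edge_min_le iB; rewrite E leqNgt ltn_ord.
Qed.

Definition opener_word M : seq nat :=
  [seq edge_min (pblock M i) | i <- enum 'I_(2 * n)].

(** The sets counted by [edge_label] are nested, and [C] itself separates them when its minimum is
    larger. *)
Lemma edge_label_lt M : {in M &, forall B C,
  (edge_label M B < edge_label M C) = (edge_min B < edge_min C)}.
Proof.
move=> B C BM CM; rewrite /edge_label; case: (ltnP (edge_min B)) => lt.
  apply: proper_card; apply/properP; split.
    by apply/subsetP => D; rewrite !inE => /andP[-> /leq_trans->] //; exact: ltnW.
  by exists C; rewrite !inE CM ?leqnn // -ltnNge.
apply/negbTE; rewrite -leqNgt; apply/subset_leq_card/subsetP => D.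
by rewrite !inE => /andP[-> /leq_trans->].
Qed.

Lemma avoids_opener M tau : is_matching M ->
  avoids M tau = ~~ word_contains (opener_word M) tau.
Proof.
case/andP=> pM _; congr (~~ _).
have bM i : pblock M i \in M by rewrite pblock_mem // (cover_partition pM).
rewrite /canonical_form /opener_word.
by apply/idP/idP; apply: word_contains_map => i j _ _; rewrite edge_label_lt ?bM.
Qed.

(** The minimum of a block belongs to it, and blocks are disjoint. *)
Lemma mem_pblock_edge_min M i j : partition M setT ->
  (j \in pblock M i) = (edge_min (pblock M j) == edge_min (pblock M i)).
Proof.
move=> pM; have tM := partition_trivIset pM.
have in_b k : k \in pblock M k by rewrite mem_pblock (cover_partition pM).
apply/idP/eqP => [ji|E]; first by rewrite (same_pblock tM ji).
have [m mi Em] := edge_min_mem (in_b i).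
have [m' mj Em'] := edge_min_mem (in_b j).
have Emm : m' = m by apply: val_inj; rewrite /= -Em -Em' E.
by rewrite -(same_pblock tM mi) -Emm (same_pblock tM mj).
Qed.

Lemma nth_opener_word M (i : 'I_(2 * n)) d :
  nth d (opener_word M) i = edge_min (pblock M i).
Proof. by rewrite (nth_map i) ?size_enum_ord // nth_ord_enum. Qed.

Lemma size_opener_word M : size (opener_word M) = 2 * n.
Proof. by rewrite size_map size_enum_ord. Qed.

Lemma opener_word_inj : {in [pred M | is_matching M] &, injective opener_word}.
Proof.
have sub M1 M2 : is_matching M1 -> is_matching M2 ->
    opener_word M1 = opener_word M2 -> {subset M1 <= M2}.
  move=> /andP[p1 _] /andP[p2 _] E B BM.
  have /set0Pn[i iB] : B != set0.
    by apply/eqP => B0; have := partition0 p1; rewrite -B0 BM.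
  rewrite -(def_pblock (partition_trivIset p1) BM iB).
  suff -> : pblock M1 i = pblock M2 i by rewrite pblock_mem // (cover_partition p2).
  apply/setP => j; rewrite !mem_pblock_edge_min //.
  by rewrite -!(nth_opener_word _ _ 0) E.
move=> M1 M2 m1 m2 E; apply/setP => B.
by apply/idP/idP; apply: sub.
Qed.

Lemma count_map_ord (f : 'I_(2 * n) -> nat) x :
  count_mem x [seq f i | i <- enum 'I_(2 * n)] = #|[set i | f i == x]|.
Proof.
by rewrite count_map cardsE cardE [in RHS]/enum_mem size_filter enumT; apply: eq_count.
Qed.

Lemma opener_word_completes M : is_matching M -> completes 0 [::] (opener_word M).
Proof.
case/andP=> pM /forall_inP card2.
have in_b k : k \in pblock M k by rewrite mem_pblock (cover_partition pM).
split=> [j|x].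
  rewrite size_opener_word => lt_j; rewrite (nth_opener_word M (Ordinal lt_j)).
  exact: edge_min_le (in_b _).
rewrite count_map_ord in_nil subn0 /= add0n.
case: (boolP (_ == x)) => [/eqP Ex|nEx].
  have lt_x : x < 2 * n.
    rewrite ltnNge; apply/negP => ge; move: Ex.
    by rewrite nth_default ?size_opener_word //; lia.
  rewrite (nth_opener_word M (Ordinal lt_x)) in Ex.
  have /card2/eqP card_x : pblock M (Ordinal lt_x) \in M.
    by rewrite pblock_mem // (cover_partition pM).
  rewrite muln1 -[RHS]card_x; apply: eq_card => i.
  by rewrite inE mem_pblock_edge_min // Ex.
(* If [x] were a letter, it would be the minimum of its own block, so position [x] would carry
   [x]. *)
rewrite muln0; apply: eq_card0 => i; rewrite inE; apply/negP => /eqP Ei.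
have [m mi Em] := edge_min_mem (in_b i).
case/negP: nEx; have <- : val m = x by rewrite -Ei Em.
move: mi; rewrite nth_opener_word mem_pblock_edge_min // => /eqP->.
by rewrite Em.
Qed.

(** The edges are the sets of positions carrying equal letters: the counts in [completes] give them
    size two, and its first clause makes the letter their minimum. *)
Lemma completes_opener_word (w : seq nat) :
  size w = 2 * n -> completes 0 [::] w ->
  exists2 M, is_matching M & opener_word M = w.
Proof.
move=> sz cw; pose g (i : 'I_(2 * n)) := nth 0 w i.
have Ew : [seq g i | i <- enum 'I_(2 * n)] = w.
  rewrite -[RHS](mkseq_nth 0) sz /mkseq -val_enum_ord -map_comp.
  exact: eq_map.
have g_mem i : g i \in w by rewrite mem_nth // sz.
pose M := preim_partition g [set: 'I_(2 * n)].
have pM : partition M setT := preim_partitionP g setT.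
have bM i j : (j \in pblock M i) = (g i == g j).
  have eqv : {in setT & &, equivalence_rel (fun x y => g x == g y)}.
    by split=> // /eqP->.
  by rewrite (pblock_equivalence_partition eqv).
exists M.
  rewrite /is_matching pM /=; apply/forall_inP => B BM.
  have /set0Pn[i iB] : B != set0.
    by apply/eqP => B0; have := partition0 pM; rewrite -B0 BM.
  rewrite -(def_pblock (partition_trivIset pM) BM iB).
  have -> : pblock M i = [set j | g j == g i].
    by apply/setP => j; rewrite bM inE eq_sym.
  rewrite -count_map_ord Ew; have [_ ->] := cw.
  have [lt_g Eg] := completes_fix cw (g_mem i).
  by rewrite in_nil subn0 (set_nth_default 0) // Eg eqxx.
rewrite -[RHS]Ew; apply: eq_map => i.
have [lt_g Eg] := completes_fix cw (g_mem i); rewrite sz in lt_g.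
have gi : Ordinal lt_g \in pblock M i by rewrite bM; apply/eqP; rewrite /g /= Eg.
apply/eqP; rewrite eqn_leq (edge_min_le gi) /=.
have [m mi ->] := edge_min_mem gi.
move: mi; rewrite bM => /eqP->; have [B _] := cw.
by have := B m; rewrite sz add0n; apply.
Qed.

Lemma card_avoiding_matchings :
  #|avoiding_matchings n [:: 1; 2; 3; 1; 2]| = walk_count (2 * n) 0 false.
Proof.
rewrite -[0 in RHS]/(size (Nil nat)) -(size_words _ 0) cardE -(size_map opener_word).
apply/perm_size/uniq_perm; last 2 first.
- exact: words_uniq.
- move=> w; apply/mapP/idP => [[M]|/mem_words0[sz [cw sf]]].
    rewrite mem_enum inE => /andP[mM avM] ->.
    have cM := opener_word_completes mM.
    apply/mem_words0; rewrite size_opener_word; do 2!split=> //.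
    by apply/(safe_avoids cM); rewrite -avoids_opener.
  have [M mM Ew] := completes_opener_word sz cw; exists M => //.
  rewrite mem_enum inE mM avoids_opener // Ew; exact/(safe_avoids cw).
rewrite map_inj_in_uniq ?enum_uniq // => M1 M2.
rewrite !mem_enum !inE => /andP[m1 _] /andP[m2 _]; exact: opener_word_inj.
Qed.

End OpenerWord.

Theorem theorem2 (n : nat) (hn : 1 <= n) :
  (#|avoiding_matchings n [:: 1; 2; 3; 1; 2]%N|%:R)%R = k_catalan n 3.
Proof. by rewrite card_avoiding_matchings walk_count_catalan. Qed.
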